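(* Let $X$ and $Y$ be real random variables with respective fixed distribution functions $F$ and $G$, let $\Delta=X-Y$, and let $J_\Delta(\cdot)$ be the distribution function of $\Delta$. For any given value $\delta$, best-possible bounds $\underline{J_\Delta}(\delta)\le J_\Delta(\delta)\le\overline{J_\Delta}(\delta)$ on $J_\Delta(\delta)$ are given by $$\underline{J_\Delta}(\delta)=\sup_{x-y=\delta}\max\{F(x)-P(Y<y),0\}=\sup_{x-y=\delta}\max\{F(x)-G(y)+P(Y=y),0\},$$ $$\overline{J_\Delta}(\delta)=1+\inf_{x-y=\delta}\min\{F(x)-P(Y<y),0\}=1+\inf_{x-y=\delta}\min\{F(x)-G(y)+P(Y=y),0\}.$$
   Context: Distribution functions are right-continuous: $F(x)=P(X\le x)$, $G(y)=P(Y\le y)$, $J_\Delta(\delta)=P(X-Y\le\delta)$. The margins $F,G$ are fixed and the joint distribution of $(X,Y)$ is unspecified. Suprema and infima are over real $x,y$. ''Best-possible bounds'' means that the bounds are valid for every joint distribution of $(X,Y)$ with margins $F,G$, and cannot be improved pointwise: for every $\delta\in\mathbb{R}$ and $\epsilon>0$ there is a joint distribution with margins $F,G$ under which $J_\Delta(\delta)<\underline{J_\Delta}(\delta)+\epsilon$, and there is a joint distribution with margins $F,G$ under which $J_\Delta(\delta)>\overline{J_\Delta}(\delta)-\epsilon$. *)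

(* Defs.v *)
From HB Require Import structures.
From mathcomp Require Import all_boot all_order all_algebra.
From mathcomp Require Import all_classical all_reals all_analysis.
From mathcomp Require Import measurable_realfun.
Import Order.TTheory GRing.Theory Num.Theory.
Import numFieldNormedType.Exports.

Set Implicit Arguments.
Unset Strict Implicit.
Unset Printing Implicit Defensive.

Local Open Scope classical_set_scope.
Local Open Scope ring_scope.

(* [cdf X] is extended-real-valued in the library; F is its real-valued form. *)
Definition has_cdf d (T : measurableType d) (R : realType)
    (P : probability T R) (X : {RV P >-> R}) (F : R -> R) : Prop :=
  forall x, cdf X x = (F x)%:E.

Definition prob_lt d (T : measurableType d) (R : realType)
    (P : probability T R) (X : {RV P >-> R}) (x : R) : R :=
  fine (P (X @^-1` `]-oo, x[)).

Definition cdf_diff d (T : measurableType d) (R : realType)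
    (P : probability T R) (X Y : {RV P >-> R}) (delta : R) : R :=
  fine (cdf (X - Y : {RV P >-> R}) delta).

(* A joint distribution with margins F and G is presented as a pair of random
   variables, with distribution functions F and G, on a common probability
   space; this space is arbitrary and is quantified together with the pair. *)
Definition best_possible_bounds (R : realType) (F G : R -> R)
    (Jlo Jhi : R -> R) : Prop :=
  [/\ forall (d : measure_display) (T : measurableType d)
        (P : probability T R) (X Y : {RV P >-> R}),
        has_cdf X F -> has_cdf Y G ->
        forall delta, Jlo delta <= cdf_diff X Y delta <= Jhi delta,
      forall delta eps, 0 < eps ->
        exists (d : measure_display) (T : measurableType d)
          (P : probability T R) (X Y : {RV P >-> R}),
          [/\ has_cdf X F, has_cdf Y G &
              cdf_diff X Y delta < Jlo delta + eps]
    & forall delta eps, 0 < eps ->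
        exists (d : measure_display) (T : measurableType d)
          (P : probability T R) (X Y : {RV P >-> R}),
          [/\ has_cdf X F, has_cdf Y G &
              Jhi delta - eps < cdf_diff X Y delta]].

Definition diff_line (R : realType) (delta : R) : set (R * R) :=
  [set p | p.1 - p.2 = delta].

(* Main.v *)
Require Import Defs.
From HB Require Import structures.
From mathcomp Require Import all_boot all_order all_algebra.
From mathcomp Require Import all_classical all_reals all_analysis.
From mathcomp Require Import measurable_realfun.
From mathcomp Require Import lra.
Import Order.TTheory GRing.Theory Num.Theory.
Import numFieldNormedType.Exports.
Local Open Scope classical_set_scope.
Local Open Scope ring_scope.

(** Write J for the distribution function of X - Y. When x - y = delta, the
    event X <= x is covered by X - Y <= delta and Y < y, while X - Y <= delta
    and Y < y together force X <= x. Hence F(x) - P(Y < y) lies between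
    J(delta) - 1 and J(delta); together with 0 <= J(delta) <= 1, which accounts
    for the truncations at 0, this bounds J(delta) for every joint law
    (lemmas [cdf_le_cdf_diff] and [cdf_diff_le_cdf]). The bounds depend on G
    only, because P(Y < y) is the left limit of G at y ([prob_lt_unique]).

    Optimality comes from explicit couplings on [0, 1] with Lebesgue measure:
    one of the two variables is the quantile transform of the uniform variable
    u, the other one the quantile transform of u rotated by s on the circle
    R/Z, that is of u - s for u > s and of u + 1 - s for u < s. Rotation
    preserves Lebesgue measure, so the margins are F and G
    ([rotated_quantile]). For u > s the quantile inequality reads
    Z(u) <= x iff u - s <= F(x), so the sign of X - Y - delta on ]s, 1[ is
    governed by comparisons between F(x) and P(Y < x - delta) alone.

    - If F(x) - P(Y < x - delta) never exceeds l < s, rotating Y by s gives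
      X - Y > delta on ]s, 1[, so that J(delta) <= s ([coupling_diff_le]);
      l is the lower bound, and s may be taken as close to it as desired.
    - If P(Y < x - delta) - F(x) never exceeds s, rotating X by s gives
      X - Y <= delta on ]s, 1[, so that J(delta) >= 1 - s
      ([coupling_diff_ge]); with 1 - s equal to the upper bound, this bound is
      attained. *)

(** * Distribution functions, left limits and quantiles *)

Section marginal_law.
Context {R : realType} {d : measure_display} {T : measurableType d}.
Context {P : probability T R}.
Implicit Types (X Y : {RV P >-> R}) (F G : R -> R).

Lemma measurable_rv_itv (X : {mfun T >-> R}) (i : interval R) :
  measurable (X @^-1` [set` i]).
Proof. exact: measurable_funPTI. Qed.
#[local] Hint Resolve measurable_rv_itv : core.

Lemma prob_ltE Y y : P (Y @^-1` `]-oo, y[) = (prob_lt Y y)%:E.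
Proof.
by rewrite /prob_lt fineK//; exact: (fin_num_measure (distribution P Y)).
Qed.

Lemma cdf_diffE X Y delta :
  P ((X - Y) @^-1` `]-oo, delta]) = (cdf_diff X Y delta)%:E.
Proof.
rewrite /cdf_diff fineK//; exact: (fin_num_measure (distribution P _)).
Qed.

Lemma cdf_diff_ge0 X Y delta : 0 <= cdf_diff X Y delta.
Proof. by rewrite -lee_fin -cdf_diffE. Qed.

Lemma cdf_diff_le1 X Y delta : cdf_diff X Y delta <= 1.
Proof. by rewrite -lee_fin -cdf_diffE probability_le1. Qed.

Lemma has_cdfE {X F} : has_cdf X F ->
  forall x, P (X @^-1` `]-oo, x]) = (F x)%:E.
Proof. by []. Qed.

Lemma has_cdf_ge0 {X F} : has_cdf X F -> forall x, 0 <= F x.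
Proof. by move=> XF x; rewrite -lee_fin -(has_cdfE XF). Qed.

Lemma has_cdf_le1 {X F} : has_cdf X F -> forall x, F x <= 1.
Proof. by move=> XF x; rewrite -lee_fin -(has_cdfE XF) probability_le1. Qed.

Lemma cdf_le_prob_lt {Y G} : has_cdf Y G ->
  forall y z, y < z -> G y <= prob_lt Y z.
Proof.
move=> YG y z yz; rewrite -lee_fin -prob_ltE -(has_cdfE YG).
apply: le_measure; rewrite ?inE//.
by apply: preimage_subset => t /=; rewrite !in_itv/= => /le_lt_trans; exact.
Qed.

(** Continuity of [P] from below: [prob_lt Y z] is the supremum of [G] on
    the left of [z]. *)
Lemma lt_prob_lt {Y G} : has_cdf Y G ->
  forall u z, u < prob_lt Y z -> exists2 y, y < z & u < G y.
Proof.
move=> YG u z uz; pose A n := Y @^-1` `]-oo, z - n.+1%:R^-1].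
have AE : Y @^-1` `]-oo, z[ = \bigcup_n A n.
  apply/seteqP; split => [t /=|t [n _]]; rewrite /A/= !in_itv/=.
    rewrite -subr_gt0 => /ltr_add_invr[n]; rewrite add0r => nt.
    by exists n => //; rewrite /A/= in_itv/= lerBrDl -lerBrDr ltW.
  by move=> Yt; rewrite (le_lt_trans Yt)// ltrBlDr ltrDl invr_gt0.
have Acvg : (P \o A) n @[n --> \oo] --> (prob_lt Y z)%:E.
  rewrite -prob_ltE AE; apply: nondecreasing_cvg_mu.
  - by move=> n; exact: measurable_rv_itv.
  - by rewrite -AE.
  - move=> m n mn; apply/subsetPset; apply: preimage_subset; apply: subset_itvl.
    by rewrite leBSide/= lerB// lef_pV2 ?posrE// ler_nat.
have [] : \forall n \near \oo, (u%:E < (P \o A) n)%E.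
  by apply: (Acvg [set p | u%:E < p]%E); apply: open_ereal_gt'; rewrite lte_fin.
move=> N _ /(_ N (leqnn N)) /=; rewrite (has_cdfE YG) lte_fin => uN.
by exists (z - N.+1%:R^-1) => //; rewrite ltrBlDr ltrDl invr_gt0.
Qed.

Lemma prob_lt_cdfB {Y G} : has_cdf Y G ->
  forall y, prob_lt Y y = G y - pmf Y y.
Proof.
move=> YG y; apply/eqP; rewrite eq_sym subr_eq eq_sym -eqe; apply/eqP.
rewrite -(has_cdfE YG) EFinD -prob_ltE /pmf fineK ?fin_num_measure//.
rewrite -measureU//; first by rewrite -preimage_setU setUitv1.
apply/seteqP; split => // t [] /=; rewrite in_itv/= => /[swap] ->.
by rewrite ltxx.
Qed.

Lemma has_cdf_lt_right {X F} : has_cdf X F ->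
  forall u x, F x < u -> exists2 y, x < y & F y < u.
Proof.
move=> XF u x xu.
have Fx : cdf X y @[y --> x^'+] --> (F x)%:E.
  by rewrite -XF; exact: cdf_right_continuous.
have : \forall y \near x^'+, (cdf X y < u%:E)%E.
  by apply: (Fx [set p | p < u%:E]%E); apply: open_ereal_lt'; rewrite lte_fin.
move=> xu'; have xx : \forall y \near x^'+, x < y by exact: nbhs_right_gt.
have [y [xy]] := @filter_ex _ _ _ _ (filterI xx xu').
by rewrite XF lte_fin => yu; exists y.
Qed.

Lemma has_cdf_gt {X F} : has_cdf X F -> forall u, u < 1 -> exists x, u < F x.
Proof.
move=> XF u u1.
have : \forall y \near +oo, (u%:E < cdf X y)%E.
  apply: (@cvg_cdfy1 _ _ _ _ X [set p | u%:E < p]%E).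
  by apply: open_ereal_gt'; rewrite lte_fin.
move=> /filter_ex[y]; rewrite XF lte_fin => uy; by exists y.
Qed.

Lemma has_cdf_lt {X F} : has_cdf X F -> forall u, 0 < u -> exists x, F x < u.
Proof.
move=> XF u u1.
have : \forall y \near -oo, (cdf X y < u%:E)%E.
  apply: (@cvg_cdfNy0 _ _ _ _ X [set p | p < u%:E]%E).
  by apply: open_ereal_lt'; rewrite lte_fin.
move=> /filter_ex[y]; rewrite XF lte_fin => uy; by exists y.
Qed.

Lemma has_cdf_homo {X F} : has_cdf X F -> {homo F : x y / x <= y}.
Proof.
by move=> XF x y xy; rewrite -lee_fin -!XF; exact: cdf_nondecreasing.
Qed.

(** The quantile [q u] is the infimum of the [x] with [u <= F x]. The limits of
    [F] at infinity make this set nonempty and bounded below for [0 < u < 1];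
    right-continuity of [F] shows that the infimum is attained. *)
Lemma has_quantile {X F} : has_cdf X F ->
  exists q : R -> R, forall u x, 0 < u < 1 -> (q u <= x) = (u <= F x).
Proof.
move=> XF; exists (fun u => inf [set x | u <= F x]) => u x /andP[u0 u1].
have lbS y : F y < u -> lbound [set x | u <= F x] y.
  move=> yu z /= uz; rewrite leNgt; apply/negP => /ltW/(has_cdf_homo XF _ _) zy.
  by have := le_lt_trans (le_trans uz zy) yu; rewrite ltxx.
apply/idP/idP => [|ux]; last first.
  have [y yu] := has_cdf_lt XF _ u0.
  by apply: ge_inf => //; exists y; exact: lbS.
apply: contraTT; rewrite -!ltNge => /(has_cdf_lt_right XF _ _)[y xy /lbS ylb].
apply: lt_le_trans xy _; apply: lb_le_inf => //.
by have [z uz] := has_cdf_gt XF _ u1; exists z; exact: ltW.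
Qed.

(** * Bounds valid for every joint law *)

(** [X <= x] implies [X - Y <= x - y] or [Y < y]. *)
Lemma cdf_le_cdf_diff {X Y F} : has_cdf X F ->
  forall x y, F x <= cdf_diff X Y (x - y) + prob_lt Y y.
Proof.
move=> XF x y; rewrite -lee_fin EFinD -cdf_diffE -prob_ltE -(has_cdfE XF).
have mXY := measurable_rv_itv (X - Y) `]-oo, x - y].
apply: le_trans (measureU2 _ _ _) => //.
apply: le_measure; rewrite ?inE//; first exact: measurableU.
move=> t /=; rewrite !in_itv/= => tx.
by have [ty|ty] := ltP (Y t) y; [right|left; rewrite /GRing.sub_fun lerB].
Qed.

(** [X - Y <= x - y] and [Y < y] together imply [X <= x]; the probability of
    this intersection is at least the sum of the two probabilities minus 1. *)
Lemma cdf_diff_le_cdf {X Y F} : has_cdf X F ->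
  forall x y, cdf_diff X Y (x - y) + prob_lt Y y <= 1 + F x.
Proof.
move=> XF x y; rewrite -lee_fin !EFinD -cdf_diffE -prob_ltE -(has_cdfE XF).
have mXY := measurable_rv_itv (X - Y) `]-oo, x - y].
set A := (X in (P X + _)%E) in mXY *; set B := (X in (P A + P X)%E).
have mB : measurable B by exact: measurable_funPTI.
rewrite -leeBlDr ?fin_num_measure//.
apply: le_trans (@probability_le1 _ _ _ P (A `|` B) _); last exact: measurableU.
rewrite measureUfinr//; last by rewrite -ge0_fin_numE// fin_num_measure.
apply: leeB => //; apply: le_measure; rewrite ?inE//; first exact: measurableI.
move=> t []; rewrite /A/B/= !in_itv/= => XYt Yt.
have {}XYt : X t - Y t <= x - y by [].
lra.
Qed.

End marginal_law.

(** This lets a bound written with one variable [Y] apply to every other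
    variable with the same distribution function. *)
Lemma prob_lt_unique {R : realType} {d d' : measure_display}
    {T : measurableType d} {T' : measurableType d'}
    {P : probability T R} {P' : probability T' R}
    {Y : {RV P >-> R}} {Y' : {RV P' >-> R}} {G : R -> R} :
  has_cdf Y G -> has_cdf Y' G -> prob_lt Y =1 prob_lt Y'.
Proof.
suff le e e' (S : measurableType e) (S' : measurableType e')
    (Q : probability S R) (Q' : probability S' R)
    (Z : {RV Q >-> R}) (Z' : {RV Q' >-> R}) :
    has_cdf Z G -> has_cdf Z' G -> forall y, prob_lt Z y <= prob_lt Z' y.
  by move=> YG YG' y; apply/eqP; rewrite eq_le !le.
move=> ZG ZG' y; rewrite leNgt; apply/negP => /(lt_prob_lt ZG)[z zy].
by rewrite ltNge (cdf_le_prob_lt ZG').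
Qed.

(** * Rotated quantile transforms on the uniform space *)

Section uniform_coupling.
Context {R : realType}.
Local Notation U := (@uniform_prob R 0 1 ltr01).

Lemma uniform_itv (x y : bool) (a b : R) : 0 <= a -> a <= b -> b <= 1 ->
  U [set` Interval (BSide x a) (BSide y b)] = (b - a)%:E.
Proof.
move=> a0 ab b1; rewrite /uniform_prob integral_uniform_pdf setIidl; last first.
  by apply: subset_itv; rewrite leBSide ?implybT.
rewrite (eq_integral (cst 1%E)) => [|t]; last first.
  rewrite inE/= in_itv/= /uniform_pdf subr0 invr1 => tab.
  suff -> : 0 <= t <= 1 by [].
  by apply/andP; move: tab; case: x y => [] [] /= /andP[]; split; lra.
rewrite integral_cst// mul1e/= lebesgue_measure_itv/= lte_fin.
by case: ltgtP ab => // -> _; rewrite subrr.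
Qed.

Lemma uniform_split (s : R) (A : set R) : 0 <= s -> s < 1 -> measurable A ->
  U A = (U (A `&` `]0%R, s[) + U (A `&` `]s, 1%R[))%E.
Proof.
move=> s0 s1 mA; pose B := (`]0, s[ `|` `]s, 1[)%classic : set R.
have dB : `]0, s[ `&` `]s, 1[ = set0 :> set R.
  by apply/seteqP; split=> // t []/=; rewrite !in_itv/= => ? ?; lra.
have mB : measurable B by exact: measurableU.
have UB : U B = 1%E.
  by rewrite measureU//= !uniform_itv// ?(ltW s1)// -EFinD; congr EFin; lra.
rewrite (measureDI U mA mB) [X in (X + _)%E](_ : _ = 0%E) ?add0e.
  rewrite setIUr measureU//; [exact: measurableI|exact: measurableI|].
  by rewrite setIACA dB setI0.
apply/eqP; rewrite eq_le measure_ge0 andbT.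
have /= := probability_setC U mB; rewrite UB subee// => <-.
by apply: le_measure; rewrite ?inE;
  [exact: measurableD|exact: measurableC|move=> t []].
Qed.

Lemma measurable_fun_itvNyc {d : measure_display} {T : measurableType d}
    (D : set T) (f : T -> R) : measurable D ->
  (forall x, measurable (D `&` f @^-1` `]-oo, x])) -> measurable_fun D f.
Proof.
move=> mD mf; apply: (measurability (@RGenOInfty.G R)).
  exact: RGenOInfty.measurableE.
move=> _ [_ [x ->] <-].
suff -> : D `&` f @^-1` `]x, +oo[ = D `\` (D `&` f @^-1` `]-oo, x]).
  exact: measurableD.
by rewrite setDIr setDv set0U -setCitvl preimage_setC setDE.
Qed.

Lemma uniform_itvI_ray (a b c : R) : 0 <= a -> a <= b -> b <= 1 ->
  U (`]a, b[ `&` `]-oo, c]) = (Num.max a (Num.min b c) - a)%:E.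
Proof.
move=> a0 ab b1; case: (ltP c b) => [cb|bc].
- case: (ltP a c) => ac.
    rewrite -(uniform_itv false false) ?(ltW ac)//; last lra.
    congr (U _); apply/seteqP.
    by split=> u /=; rewrite !in_itv/=; [case|split]; lra.
  rewrite subrr (_ : _ `&` _ = set0) ?measure0//.
  by apply/seteqP; split=> // u []/=; rewrite !in_itv/=; lra.
- rewrite (max_idPr ab) -(uniform_itv false true)//; congr (U _).
  by apply/seteqP; split=> u /=; rewrite !in_itv/=; [case|split]; lra.
Qed.

(** [Z] is the quantile transform of [u] rotated by [s] on the circle. The two
    arcs [A] and [B] are the ones on which rotation adds [1 - s], respectively
    subtracts [s]; the removed points [0], [s] and [1], at which the rotated
    parameter may be [0] or [1] and the quantile meaningless, have measure 0. *)
Lemma rotated_quantile {d : measure_display} {T : measurableType d}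
    {P : probability T R} {X : {RV P >-> R}} {F : R -> R} (s : R) :
  has_cdf X F -> 0 <= s -> s < 1 ->
  exists2 Z : {RV U >-> R}, has_cdf Z F &
    forall u x, s < u < 1 -> (Z u <= x) = (u - s <= F x).
Proof.
move=> XF s0 s1; have [q qE] := has_quantile XF.
pose A := `]0, s[%classic : set R; pose B := `]s, 1[%classic : set R.
pose f u := if u <= s then q (u + 1 - s) else q (u - s).
have fA u x : A u -> (f u <= x) = (u <= F x + s - 1).
  rewrite /A/f/= in_itv/= => /andP[u0 us]; rewrite (ltW us) qE; last lra.
  by apply/idP/idP; lra.
have fB u x : B u -> (f u <= x) = (u <= F x + s).
  rewrite /B/f/= in_itv/= => /andP[us u1].
  rewrite [u <= s]leNgt us/= qE; last lra.
  by apply/idP/idP; lra.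
have fAE x : A `&` f @^-1` `]-oo, x] = A `&` `]-oo, F x + s - 1].
  by apply/seteqP; split=> u [Au] /=; rewrite !in_itv/= fA.
have fBE x : B `&` f @^-1` `]-oo, x] = B `&` `]-oo, F x + s].
  by apply/seteqP; split=> u [Bu] /=; rewrite !in_itv/= fB.
pose z := f \_ (A `|` B).
have zf u : (A `|` B) u -> z u = f u by move=> ABu; rewrite /z patchE mem_set.
have mz : measurable_fun [set: measurableTypeR R] z.
  have mAB : measurable (A `|` B) by apply: measurableU; exact: measurable_itv.
  apply/(measurable_restrictT f mAB); apply: measurable_fun_itvNyc => // x.
  rewrite setIUl fAE fBE.
  by apply: measurableU; apply: measurableI => //; exact: measurable_itv.
pose Z : {RV U >-> R} := @mfun_Sub _ _ (measurableTypeR R) _ z (mem_set mz).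
exists Z => [x|u x su]; last first.
  rewrite /= zf ?fB /B/=; [|by rewrite in_itv|by right; rewrite /= in_itv].
  by rewrite lerBlDr.
have mZ : measurable (Z @^-1` `]-oo, x]) by exact: measurable_funPTI.
transitivity (U (Z @^-1` `]-oo, x])) => //; rewrite (uniform_split s)//.
have -> : Z @^-1` `]-oo, x] `&` `]0, s[ = `]0, s[ `&` `]-oo, F x + s - 1].
  rewrite -fAE setIC; apply/seteqP; split=> u [Au]; rewrite /= zf//; by left.
have -> : Z @^-1` `]-oo, x] `&` `]s, 1[ = `]s, 1[ `&` `]-oo, F x + s].
  rewrite -fBE setIC; apply/seteqP; split=> u [Au]; rewrite /= zf//; by right.
have F0 := has_cdf_ge0 XF x; have F1 := has_cdf_le1 XF x.
rewrite !uniform_itvI_ray// ?(ltW s1)// -EFinD; congr EFin.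
(* The two arcs contribute min(F x, 1 - s) and max(0, F x + s - 1). *)
by case: (ltP s (F x + s - 1)) => ?; case: (ltP 1 (F x + s)) => ?;
  case: (ltP 0 (F x + s - 1)) => ?; case: (ltP s 1) => ?;
  case: (ltP s (F x + s)) => ?; lra.
Qed.

End uniform_coupling.

(** * Couplings that approach the bounds *)

Section sharpness.
Context {R : realType} {d : measure_display} {T : measurableType d}.
Context {P : probability T R} {X Y : {RV P >-> R}} {F G : R -> R}.
Local Notation U := (@uniform_prob R 0 1 ltr01).

(** For [u > s], the value [x] of the unrotated [X0] satisfies [u <= F x], hence
    [u - s < prob_lt Y (x - delta)], so that the rotated [Y0] stays strictly
    below [x - delta]. The strict inequality [l < s] is what turns the bound
    into one on a left limit, and hence on [G] at some [y < x - delta]. *)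
Lemma coupling_diff_le (delta l s : R) : has_cdf X F -> has_cdf Y G ->
  0 <= l -> l < s -> s < 1 ->
  (forall x, F x - prob_lt Y (x - delta) <= l) ->
  exists X0 Y0 : {RV U >-> R},
    [/\ has_cdf X0 F, has_cdf Y0 G & cdf_diff X0 Y0 delta <= s].
Proof.
move=> XF YG l0 ls s1 Fl; have s0 : 0 <= s by lra.
have [X0 X0F X0E] := rotated_quantile 0 XF (lexx 0) ltr01.
have [Y0 Y0G Y0E] := rotated_quantile s YG s0 s1.
exists X0, Y0; split => //.
have XY u : s < u < 1 -> delta < X0 u - Y0 u.
  move=> us; set x := X0 u.
  have uF : u <= F x by rewrite -[u]subr0 -X0E//; lra.
  have [] := lt_prob_lt YG (u - s) (x - delta); first by have := Fl x; lra.
  by move=> y yx /ltW; rewrite -Y0E//; lra.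
set A := (X0 - Y0) @^-1` `]-oo, delta].
have mA : measurable A by exact: measurable_rv_itv.
have dA : A `&` `]s, 1[ = set0.
  apply/seteqP; split => // u []; rewrite /A/= !in_itv/= => XYu /XY.
  by rewrite ltNge => /negP; apply.
have : (U (A `|` `]s, 1%R[) <= 1)%E.
  apply: probability_le1; apply: measurableU => //; exact: measurable_itv.
rewrite measureU//= uniform_itv//; last exact: ltW.
by rewrite cdf_diffE -EFinD lee_fin; lra.
Qed.

(** For [u > s], the value [y] of the unrotated [Y0] satisfies [u <= G y], and
    [G y <= prob_lt Y (x - delta)] as soon as [x > y + delta]. Hence
    [u - s <= F x], so the rotated [X0] is at most every such [x]. *)
Lemma coupling_diff_ge (delta s : R) : has_cdf X F -> has_cdf Y G ->
  0 <= s -> s < 1 ->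
  (forall x, prob_lt Y (x - delta) - F x <= s) ->
  exists X0 Y0 : {RV U >-> R},
    [/\ has_cdf X0 F, has_cdf Y0 G & 1 - s <= cdf_diff X0 Y0 delta].
Proof.
move=> XF YG s0 s1 Fs.
have [X0 X0F X0E] := rotated_quantile s XF s0 s1.
have [Y0 Y0G Y0E] := rotated_quantile 0 YG (lexx 0) ltr01.
exists X0, Y0; split => //.
rewrite -lee_fin -cdf_diffE -(uniform_itv false true)//; last exact: ltW.
apply: le_measure; rewrite ?inE//; first exact: measurable_rv_itv.
move=> u /=; rewrite !in_itv/= => us.
suff : X0 u <= Y0 u + delta by rewrite -lerBlDl.
have uG : u <= G (Y0 u).
  by have := Y0E u (Y0 u); rewrite lexx subr0 => <- //; lra.
(* Any point x strictly between the two sides leads to a contradiction. *)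
rewrite leNgt; apply/negP => /midf_lt.
set x := _ / _ => -[xl xr].
have := cdf_le_prob_lt YG (Y0 u) (x - delta); have := Fs x.
have := X0E u x us; rewrite leNgt xr/= => /esym/negbT; lra.
Qed.

End sharpness.

Theorem theorem25 (R : realType) (d : measure_display) (T : measurableType d)
    (P : probability T R) (X Y : {RV P >-> R}) (F G : R -> R)
    (hF : has_cdf X F) (hG : has_cdf Y G) :
  let Jlo := fun delta : R =>
    sup [set Num.max (F p.1 - prob_lt Y p.2) 0 | p in diff_line delta] in
  let Jhi := fun delta : R =>
    1 + inf [set Num.min (F p.1 - prob_lt Y p.2) 0 | p in diff_line delta] in
  [/\ best_possible_bounds F G Jlo Jhi,
      forall delta : R, Jlo delta =
        sup [set Num.max (F p.1 - G p.2 + pmf Y p.2) 0 | p in diff_line delta]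
    & forall delta : R, Jhi delta =
        1 + inf [set Num.min (F p.1 - G p.2 + pmf Y p.2) 0
                | p in diff_line delta]].
Proof.
move=> Jlo Jhi.
pose lo delta x := Num.max (F x - prob_lt Y (x - delta)) 0.
pose hi delta x := Num.min (F x - prob_lt Y (x - delta)) 0.
have diff_lineE (f : R * R -> R) delta :
    [set f p | p in diff_line delta] = range (fun x => f (x, x - delta)).
  apply/seteqP; split => [_ [[x y] /= <- <-]|_ [x _ <-]].
    by exists x => //; congr (f (_, _)) => /=; lra.
  by exists (x, x - delta) => //; rewrite /diff_line/=; lra.
have JloE delta : Jlo delta = sup (range (lo delta)) by rewrite /Jlo diff_lineE.
have JhiE delta : Jhi delta = 1 + inf (range (hi delta)).
  by rewrite /Jhi diff_lineE.
have valid d' (T' : measurableType d') (P' : probability T' R)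
    (X' Y' : {RV P' >-> R}) : has_cdf X' F -> has_cdf Y' G ->
    forall delta x, lo delta x <= cdf_diff X' Y' delta <= 1 + hi delta x.
  move=> XF YG delta x; rewrite /lo /hi (prob_lt_unique hG YG).
  have := @cdf_le_cdf_diff _ _ _ _ X' Y' F XF x (x - delta).
  have := @cdf_diff_le_cdf _ _ _ _ X' Y' F XF x (x - delta).
  have := cdf_diff_ge0 X' Y' delta; have := cdf_diff_le1 X' Y' delta.
  rewrite (_ : x - (x - delta) = delta); last lra.
  by case: (leP (F x - prob_lt Y' (x - delta)) 0); lra.
have lo_nonempty delta : range (lo delta) !=set0 by exists (lo delta 0), 0.
have hi_nonempty delta : range (hi delta) !=set0 by exists (hi delta 0), 0.
have lo_ub delta : ubound (range (lo delta)) (cdf_diff X Y delta).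
  by move=> _ [x _ <-]; have /andP[] := valid _ _ _ X Y hF hG delta x.
have hi_lb delta : lbound (range (hi delta)) (cdf_diff X Y delta - 1).
  move=> _ [x _ <-]; have /andP[_] := valid _ _ _ X Y hF hG delta x; lra.
have lo_le delta x : lo delta x <= Jlo delta.
  rewrite JloE; apply: ub_le_sup; last by exists x.
  by exists (cdf_diff X Y delta).
have hi_ge delta x : Jhi delta <= 1 + hi delta x.
  rewrite JhiE lerD2l; apply: ge_inf; last by exists x.
  by exists (cdf_diff X Y delta - 1).
split; last 2 first.
- move=> delta; rewrite /Jlo; congr sup; apply: eq_imagel => p _.
  by rewrite (prob_lt_cdfB hG) opprB addrA addrAC.
- move=> delta; rewrite /Jhi; congr (1 + inf _); apply: eq_imagel => p _.
  by rewrite (prob_lt_cdfB hG) opprB addrA addrAC.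
split.
- move=> d' T' P' X' Y' XF YG delta; apply/andP; split.
    rewrite JloE; apply: ge_sup => // _ [x _ <-].
    by have /andP[] := valid _ _ _ X' Y' XF YG delta x.
  rewrite JhiE -lerBlDl; apply: lb_le_inf => // _ [x _ <-].
  by have /andP[_] := valid _ _ _ X' Y' XF YG delta x; lra.
- move=> delta eps eps0; have [small|big] := ltP (Jlo delta + eps / 2) 1.
    have J0 : 0 <= Jlo delta.
      by apply: le_trans (lo_le delta 0); rewrite /lo le_max lexx orbT.
    have [] := @coupling_diff_le _ _ _ _ X Y F G delta (Jlo delta)
      (Jlo delta + eps / 2) hF hG.
    + exact: J0.
    + lra.
    + exact: small.
    + by move=> x; apply: le_trans (lo_le delta x); rewrite /lo le_max lexx.
    move=> X0 [Y0 [X0F Y0G XY]].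
    eexists _, _, _, X0, Y0; split => //; lra.
  (* The target [Jlo delta + eps] exceeds 1: every coupling will do. *)
  exists d, T, P, X, Y; split => //.
  by have := cdf_diff_le1 X Y delta; lra.
- move=> delta eps eps0; have [pos|neg] := ltP 0 (Jhi delta).
    have [] := @coupling_diff_ge _ _ _ _ X Y F G delta (1 - Jhi delta) hF hG.
    + have : hi delta 0 <= 0 by rewrite /hi ge_min lexx orbT.
      by have := hi_ge delta 0; lra.
    + lra.
    + move=> x; have := hi_ge delta x.
      have : hi delta x <= F x - prob_lt Y (x - delta).
        by rewrite /hi ge_min lexx.
      by lra.
    move=> X0 [Y0 [X0F Y0G XY]].
    eexists _, _, _, X0, Y0; split => //; lra.
  (* The target [Jhi delta - eps] is negative: every coupling will do. *)
  exists d, T, P, X, Y; split => //.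
  by have := cdf_diff_ge0 X Y delta; lra.
Qed.
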